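(* Let $v \geq 4$ be an integer. If there exists a $\mathrm{TTS}(v)$ with a Hamiltonian $2$-BIG, then there exists a $\mathrm{TTS}(3v)$ with a Hamiltonian $2$-BIG.
   Context: A twofold triple system of order $v$, denoted $\mathrm{TTS}(v)$, is a pair $(V,\mathcal{B})$ where $V$ is a set of $v$ points and $\mathcal{B}$ is a collection of $3$-element subsets of $V$ (called blocks or triples; repeated blocks are permitted, i.e. $\mathcal{B}$ is a multiset) such that each $2$-element subset of $V$ is contained in exactly two blocks of $\mathcal{B}$, counted with multiplicity. The $2$-block-intersection graph ($2$-BIG) of $(V,\mathcal{B})$ is the graph whose vertices are the blocks in $\mathcal{B}$ (repeated blocks giving distinct vertices), where two vertices $B_1,B_2$ are adjacent if and only if $|B_1\cap B_2|=2$. A graph is Hamiltonian if it contains a Hamilton cycle (a cycle, of length at least $3$, through all vertices). *)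

(* Defs.v *)
From mathcomp Require Import all_boot.

Set Implicit Arguments.
Unset Strict Implicit.
Unset Printing Implicit Defensive.

(* The multiset of blocks is a finite family [block] indexed by [tts_index]:
   a block of multiplicity m is the value of [block] at m distinct indices. *)
Record tts (v : nat) := TTS {
  tts_point : finType;
  tts_index : finType;
  block : tts_index -> {set tts_point};
  card_tts_point : #|tts_point| = v;
  card_block : forall i, #|block i| = 3;
  block_pair : forall P : {set tts_point},
    #|P| = 2 -> #|[set i | P \subset block i]| = 2
}.

(* The vertices are the indices, so repeated blocks give distinct vertices;
   these are not adjacent to each other, since they meet in 3 points. *)
Definition big2 (v : nat) (D : tts v) : rel (tts_index D) :=
  [rel i j | #|block i :&: block j| == 2].
Arguments big2 {v} D _ _.

Definition hamiltonian (T : finType) (e : rel T) : Prop :=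
  exists c : seq T, [/\ 3 <= size c, cycle e c, uniq c & forall x, x \in c].

Lemma big2_sym (v : nat) (D : tts v) : symmetric (big2 D).
Proof. by move=> i j; rewrite /big2 /= setIC. Qed.

Lemma big2_irr (v : nat) (D : tts v) : irreflexive (big2 D).
Proof. by move=> i; rewrite /big2 /= setIid card_block. Qed.

(* Main.v *)
Require Import Defs.
From mathcomp Require Import all_boot.
From mathcomp Require Import perm all_algebra ring zify.

(** Take three copies of the given TTS(v), on the levels Z_v x {k}, together with
    the transversal triples f(a,b) = {a_0, b_1, (-a-b)_2} and
    g(a,b) = {a_0, b_1, (1-a-b)_2}. This is a TTS(3v) whose 2-BIG has four
    components: the three copies, and a honeycomb torus formed by the cells f, g.
    In each copy pick a block, label it 0, 1, 2 on levels 0 and 1 and -3, -2, -1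
    on level 2, and exchange these three blocks and the six f(a,b) with
    a <> b in {0,1,2} for nine triples covering the same pairs; this joins the
    four components. A Hamilton cycle of the given system minus the picked block
    is a path, so each copy can be crossed in one stretch when entered through the
    right triples. The remaining cells are collected along the rows of the torus:
    row r > 2 is run through completely from f(r,2) to g(r,2), which is adjacent
    to f(r-1,2), and the rows 0, 1, 2 are linked with the new triples and the
    copies by a path that does not depend on v. *)

Set Implicit Arguments.
Unset Strict Implicit.
Unset Printing Implicit Defensive.

Import GRing.Theory.

(** * Block families over fixed point and index types, and their relabelling *)

Definition twofold (T I : finType) (B : I -> {set T}) :=
  (forall i, #|B i| = 3) /\
  (forall P : {set T}, #|P| = 2 -> #|[set i | P \subset B i]| = 2).

Lemma cards3 (T : finType) (a b c : T) :
  uniq [:: a; b; c] -> #|[set a; b; c]| = 3.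
Proof.
rewrite /= !inE negb_or !andbT => /andP[/andP[ab ac] bc].
by rewrite setUC cardsU1 cards2 !inE negb_or ab eq_sym ac eq_sym bc.
Qed.

Definition meet2 (T I : finType) (B : I -> {set T}) : rel I :=
  [rel i j | #|B i :&: B j| == 2].

Lemma twofold_hamiltonian (v : nat) (T I : finType) (B : I -> {set T}) :
  #|T| = v -> twofold B -> hamiltonian (meet2 B) ->
  exists D : tts v, hamiltonian (big2 D).
Proof.
move=> cT [c3 c2] [c hc]; exists (TTS cT c3 c2); exists c.
by move: hc; rewrite /big2 /=.
Qed.

Lemma subset_imset_can (T U : finType) (phi : T -> U) (psi : U -> T)
    (P : {set U}) (X : {set T}) :
  cancel phi psi -> cancel psi phi ->
  (P \subset phi @: X) = (psi @: P \subset X).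
Proof.
move=> phiK psiK; apply/subsetP/subsetP => sub u.
  by case/imsetP=> w wP ->; have /imsetP[t tX ->] := sub w wP; rewrite phiK.
by move=> uP; rewrite -[u]psiK imset_f // sub // imset_f.
Qed.

Lemma twofold_relabel (T U I : finType) (B : I -> {set T}) (phi : T -> U) :
  bijective phi -> twofold B -> twofold (fun i => phi @: B i).
Proof.
move=> bphi [c3 c2]; have iphi := bij_inj bphi.
case: bphi => psi phiK psiK; split=> [i|P cP]; first by rewrite card_imset.
rewrite -(c2 (psi @: P)); last by rewrite card_imset //; apply: can_inj psiK.
by apply: eq_card => i; rewrite !inE (subset_imset_can _ _ phiK psiK).
Qed.

Lemma meet2_relabel (T U I : finType) (B : I -> {set T}) (phi : T -> U) :
  injective phi -> meet2 (fun i => phi @: B i) =2 meet2 B.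
Proof.
by move=> iphi i j; rewrite /meet2 /= -imsetI ?card_imset // => x y _ _; apply: iphi.
Qed.

(** Three transpositions in turn: each sends one more point to its target and fixes the targets
    already reached. *)
Lemma inj_three_transitive (T : finType) (a b c a' b' c' : T) :
  uniq [:: a; b; c] -> uniq [:: a'; b'; c'] ->
  exists s : T -> T, [/\ injective s, s a = a', s b = b' & s c = c'].
Proof.
rewrite /= !inE !negb_or !andbT => /andP[/andP[ab ac] bc] /andP[/andP[ab' ac'] bc'].
pose s1 := tperm a a'; pose s2 := tperm (s1 b) b'.
pose s3 := tperm (s2 (s1 c)) c'.
have s1a : s1 a = a' by rewrite tpermL.
have s2a : s2 a' = a'.
  by rewrite tpermD // 1?eq_sym // -s1a (inj_eq perm_inj).
have s2b : s2 (s1 b) = b' by rewrite tpermL.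
exists (s3 \o (s2 \o s1)); rewrite /= s1a s2a s2b tpermL; split=> //.
- by do 2![apply: inj_comp; first exact: perm_inj]; apply: perm_inj.
- by rewrite tpermD 1?eq_sym // -s2a -s1a !(inj_eq perm_inj).
by rewrite tpermD 1?eq_sym // -s2b !(inj_eq perm_inj).
Qed.

Lemma bij_three_transitive (T U : finType) (a b c : T) (a' b' c' : U) :
  #|T| = #|U| -> uniq [:: a; b; c] -> uniq [:: a'; b'; c'] ->
  exists phi : T -> U, [/\ bijective phi, phi a = a', phi b = b' & phi c = c'].
Proof.
move=> cTU u u'.
pose h x := enum_val (cast_ord cTU (enum_rank x)).
have bh : bijective h.
  exists (fun y => enum_val (cast_ord (esym cTU) (enum_rank y))) => x;
  by rewrite /h enum_valK ?cast_ordK ?cast_ordKV enum_rankK.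
have [||s [is_ sa sb sc]] := @inj_three_transitive U (h a) (h b) (h c) a' b' c'.
- by rewrite -[[:: _; _; _]]/(map h [:: a; b; c]) map_inj_uniq //; apply: bij_inj.
- by [].
by exists (s \o h); split=> //; apply: bij_comp => //; apply: injF_bij.
Qed.

(** * Opening a Hamilton cycle at a block *)

(** Deleting [A] from the cycle leaves a path between its two neighbours. The pairs that [A] shares
    with them are distinct, since a common pair would lie in three blocks, and two distinct pairs in
    a triple meet in one point [u]. *)
Lemma hamiltonian_rooted_path (v : nat) (D : tts v) (c : seq (tts_index D)) :
  3 <= size c -> cycle (big2 D) c -> uniq c -> (forall i, i \in c) ->
  exists (A b : tts_index D) (p : seq (tts_index D)) (u w w' : tts_point D),
    [/\ [/\ uniq [:: A, b & p] & forall i, i \in [:: A, b & p]],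
        path (big2 D) b p, uniq [:: u; w; w'], block A = [set u; w; w'] &
        [/\ [set u; w] \subset block b &
        [set u; w'] \subset block (last b p)]].
Proof.
case: c => [|A [|b p]] //= sz; rewrite rcons_path => /andP[eAb /andP[pth edA]] un al.
exists A, b, p; set d := last b p in edA *.
(* Length at least 3 makes [p] nonempty, so the two neighbours of [A] differ. *)
have bd : b != d.
  case: p @d sz un {al pth edA} => //= x p _ /and3P[_ + _].
  by apply: contraNneq => ->; apply: mem_last.
have Ad : A != d.
  by case/andP: un => + _; apply: contraNneq => ->; apply: mem_last.
have Ab : A != b by apply: contraTneq eAb => ->; rewrite big2_irr.
rewrite big2_sym in edA.
pose Q := block A :&: block b; pose Q' := block A :&: block d.
have cQ : #|Q| = 2 by apply/eqP.
have cQ' : #|Q'| = 2 by apply/eqP.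
have QQ' : Q != Q'.
  apply/eqP => E; have := block_pair cQ.
  suff: 3 <= #|[set i | Q \subset block i]| by move=> + H; rewrite H.
  have <- : #|[set A; b; d]| = 3.
    by rewrite cards3 //= !inE negb_or Ab Ad bd.
  apply/subset_leq_card/subsetP => i; rewrite !inE.
  case/orP=> [/orP[]|] /eqP ->; rewrite /Q ?subsetIl ?subsetIr //.
  by rewrite -/Q E subsetIr.
have cA := card_block A.
have : #|Q :|: Q'| <= 3.
  by rewrite -cA subset_leq_card // subUset !subsetIl.
rewrite cardsU cQ cQ' => cU.
have /set0Pn[u uQQ'] : Q :&: Q' != set0 by rewrite -card_gt0; lia.
case/setIP: uQQ' => uQ uQ'.
have /cards1P[w Qw] : #|Q :\ u| == 1.
  by have := cardsD1 u Q; rewrite uQ cQ add1n => -[<-].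
have /cards1P[w' Qw'] : #|Q' :\ u| == 1.
  by have := cardsD1 u Q'; rewrite uQ' cQ' add1n => -[<-].
have dQ : Q = [set u; w] by rewrite -(setD1K uQ) Qw.
have dQ' : Q' = [set u; w'] by rewrite -(setD1K uQ') Qw'.
have uw : u != w by move: cQ; rewrite dQ cards2; case: (u != w).
have uw' : u != w' by move: cQ'; rewrite dQ' cards2; case: (u != w').
have ww' : w != w' by apply: contraNneq QQ' => E; rewrite dQ dQ' E.
exists u, w, w'; split=> //; last by rewrite -dQ -dQ' !subsetIr.
  by rewrite /= !inE negb_or uw uw' ww'.
have c3 : #|[set u; w; w']| = 3.
  by rewrite cards3 //= !inE negb_or uw uw' ww'.
apply/esym/eqP; rewrite eqEcard cA c3 leqnn andbT.
rewrite subUset -dQ subsetIl sub1set.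
by have : w' \in Q' by [rewrite dQ' !inE eqxx orbT]; case/setIP.
Qed.

(** [A], [b] and [p] are chosen before [u], [w], [w']: the three copies then share one index
    sequence and differ only in how their points are named. *)
Lemma hamiltonian_rooted_relabel (v : nat) (D : tts v) (U : finType) :
  #|U| = v -> hamiltonian (big2 D) ->
  exists (A b : tts_index D) (p : seq (tts_index D)),
    [/\ uniq [:: A, b & p], forall i, i \in [:: A, b & p] &
     forall u w w' : U, uniq [:: u; w; w'] ->
     exists B : tts_index D -> {set U},
       [/\ twofold B, B A = [set u; w; w'], path (meet2 B) b p,
           [set u; w] \subset B b & [set u; w'] \subset B (last b p)]].
Proof.
move=> cU [c [sz cyc un al]].
have [A [b [p [u [w [w' [[un' al'] pth uu dA [sub sub']]]]]]]] :=
  hamiltonian_rooted_path sz cyc un al.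
exists A, b, p; split=> // x y y' ux.
have [|phi [bphi phiu phiw phiw']] := bij_three_transitive _ uu ux.
  by rewrite cU card_tts_point.
exists (fun i => phi @: block i); split.
- apply: twofold_relabel => //; split; [exact: card_block|exact: block_pair].
- by rewrite dA !imsetU !imset_set1 phiu phiw phiw'.
- by rewrite (eq_path (meet2_relabel _ (bij_inj bphi))).
- by rewrite -phiu -phiw -!imset_set1 -imsetU imsetS.
by rewrite -phiu -phiw' -!imset_set1 -imsetU imsetS.
Qed.

(** * Counting in triples *)

(** The point [c] makes the intersection a proper subset of [X], which bounds it above; [a] and [b]
    bound it below. Every adjacency not internal to a copy comes from this criterion. *)
Lemma card_setI_pair (T : finType) (X Y : {set T}) (a b c : T) :
  #|X| = 3 -> #|Y| = 3 -> a != b -> a \in X -> b \in X -> a \in Y -> b \in Y ->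
  c \in X -> c \notin Y -> #|X :&: Y| == 2.
Proof.
move=> cX cY ab aX bX aY bY cX' cY'; rewrite eqn_leq; apply/andP; split.
  rewrite -ltnS -cX; apply: proper_card; rewrite properE subsetIl.
  by apply/subsetPn; exists c; rewrite // !inE negb_and cY' orbT.
have <- : #|[set a; b]| = 2 by rewrite cards2 ab.
by rewrite subset_leq_card // subUset !sub1set !inE aX bX aY bY.
Qed.

(** Containment as a sum of indicators of pairs turns the balance of a trade into a linear
    identity. *)
Lemma subset_pair_triple (T : finType) (P : {set T}) (a b c : T) :
  #|P| = 2 -> uniq [:: a; b; c] ->
  nat_of_bool (P \subset [set a; b; c]) =
  (P == [set a; b]) + (P == [set a; c]) + (P == [set b; c]).
Proof.
move=> cP; rewrite /= !inE negb_or !andbT => /andP[/andP[ab ac] bc].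
have eqP2 x y : x != y -> (P == [set x; y]) = (x \in P) && (y \in P).
  by move=> xy; rewrite eq_sym eqEcard cards2 xy cP andbT subUset !sub1set.
rewrite !eqP2 //; set S := [set a; b; c].
have cPS : #|P :&: S| = (a \in P) + (b \in P) + (c \in P).
  rewrite (cardsD1 a) (cardsD1 b) (cardsD1 c).
  have -> : (P :&: S) :\ a :\ b :\ c = set0.
    apply/setP=> x; rewrite !inE; case: (x == a); case: (x == b);
    by case: (x == c); rewrite ?andbF.
  rewrite cards0 !inE !eqxx ?(eq_sym b a) ?(eq_sym c a) ?(eq_sym c b).
  by rewrite (negbTE ab) (negbTE ac) (negbTE bc) ?orbT ?andbT /= !addnA addn0.
(* Containment becomes a count, so both sides depend only on which of [a], [b], [c] lie in [P]. *)
have -> : (P \subset S) = (#|P| <= #|P :&: S|).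
  by rewrite (sameP setIidPl eqP) eqEcard subsetIl.
have : #|P :&: S| <= 2 by rewrite -cP subset_leq_card // subsetIl.
by rewrite cP cPS; case: (a \in P); case: (b \in P); case: (c \in P).
Qed.

(** * Replacing blocks at prescribed indices *)

Section Override.
Variables (T I : finType) (B : I -> {set T}) (s : seq I) (N : seq {set T}).
Hypotheses (us : uniq s) (sN : size N = size s).

(** Replacement by position keeps the index type, so the vertices of the graph stay the same; the
    default [set0] is out of reach because [N] and [s] have equal length. *)
Definition override (i : I) : {set T} :=
  if i \in s then nth set0 N (index i s) else B i.

Lemma override_nth i0 j : j < size s -> override (nth i0 s j) = nth set0 N j.
Proof. by move=> js; rewrite /override mem_nth // index_uniq. Qed.

Lemma map_override : map override s = N.
Proof.
apply: (@eq_from_nth _ set0); rewrite size_map // => j js.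
have i0 : I by case: s js.
by rewrite (nth_map i0) // override_nth.
Qed.

Lemma override_out i : i \notin s -> override i = B i.
Proof. by rewrite /override => /negbTE ->. Qed.

(** The number of blocks through a pair splits into the indices in [s], where the sums agree by
    hypothesis, and the others, whose blocks are unchanged. *)
Lemma twofold_override :
  twofold B -> (forall X, X \in N -> #|X| = 3) ->
  (forall P : {set T}, #|P| = 2 ->
    \sum_(i <- s) (P \subset B i) = \sum_(X <- N) (P \subset X)) ->
  twofold override.
Proof.
move=> [c3 c2] N3 eqN; split=> [i|P cP].
  rewrite /override; case: ifP => // si; apply: N3.
  by rewrite mem_nth // sN index_mem.
have cnt (F : I -> {set T}) :
    #|[set i | P \subset F i]| = \sum_(i <- s) (P \subset F i)
      + \sum_(i | i \notin s) (P \subset F i).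
  rewrite -sum1_card big_mkcond (bigID (mem s)) /= big_uniq //.
  by congr (_ + _); apply: eq_bigr => i _; rewrite inE; case: (_ \subset _).
rewrite -(c2 P cP) !cnt eqN //; congr (_ + _).
  by rewrite -map_override big_map.
by apply: eq_bigr => i si; rewrite override_out.
Qed.
End Override.

(** * A trade of nine triples *)

Section Trade.
Variable T : finType.
Variables x0 y0 z0 x1 y1 z1 x2 y2 z2 : T.

(** These are the triples {x_i, y_j, z_k} with i + j + k = 0 modulo 3, a Latin square: they split
    the edges of the complete tripartite graph on the classes x, y, z. *)
Definition trade_old : seq {set T} :=
  [:: [set x0; y0; z0]; [set x1; y1; z1]; [set x2; y2; z2];
      [set x0; y1; z2]; [set x0; z1; y2]; [set y0; x1; z2];
      [set y0; z1; x2]; [set z0; x1; y2]; [set z0; y1; x2]].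

(** The same with i + j + k = 1 modulo 3, so the same pairs are covered. Exactly two of i, j, k now
    coincide: each triple spans two levels, whereas the old ones span one or three. *)
Definition trade_new : seq {set T} :=
  [:: [set y0; z0; x1]; [set y1; z1; x2]; [set x0; y2; z2];
      [set x1; z1; y2]; [set x1; y1; z2]; [set z0; x2; y2];
      [set y0; x2; z2]; [set x0; z0; y1]; [set x0; y0; z1]].

Hypothesis upts : uniq [:: x0; y0; z0; x1; y1; z1; x2; y2; z2].

Lemma trade_new_card X : X \in trade_new -> #|X| = 3.
Proof.
move: upts; rewrite /trade_new /= !inE !negb_or !andbT -!andbA.
do !case/andP=> ?; move=> ?; do !case/orP; move/eqP=> ->.
all: by rewrite cards3 //= !inE negb_or andbT; do ![apply/andP; split].
Qed.

Lemma trade_balance (P : {set T}) : #|P| = 2 ->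
  \sum_(X <- trade_old) (P \subset X) = \sum_(X <- trade_new) (P \subset X).
Proof.
move=> cP; rewrite /trade_old /trade_new !big_cons !big_nil.
rewrite !subset_pair_triple //; first last.
1-18: move: upts; rewrite /= !inE !negb_or !andbT -!andbA.
1-18: do !case/andP=> ?; move=> ?; by do ![apply/andP; split].
(* Both sides are now sums over the same 27 pairs. *)
repeat match goal with
  |- context [nat_of_bool ?b] => generalize (nat_of_bool b); intro
end.
lia.
Qed.
End Trade.

Lemma mem_catl (T : eqType) (x : T) s t : x \in s -> x \in s ++ t.
Proof. by rewrite mem_cat => ->. Qed.

Lemma mem_catr (T : eqType) (x : T) s t : x \in t -> x \in s ++ t.
Proof. by rewrite mem_cat orbC => ->. Qed.

Lemma mem_consr (T : eqType) (x y : T) s : x \in s -> x \in y :: s.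
Proof. by rewrite in_cons orbC => ->. Qed.

(** * The tripled system *)

(* The three levels are the elements of [option bool], on which equality and case
   analysis compute. *)
Notation lev0 := (None : option bool).
Notation lev1 := (Some false : option bool).
Notation lev2 := (Some true : option bool).

Lemma third_level (k l : option bool) : k != l -> exists2 h, h != k & h != l.
Proof.
by case: k l => [[]|] [[]|] // _;
  first [by exists lev0 | by exists lev1 | by exists lev2].
Qed.

Section Tripling.
Local Open Scope ring_scope.

Variables (n : nat) (I : finType).
Notation Z := 'I_n.+4.
Notation point := (option bool * Z)%type.
Notation index := (option bool * I + bool * (Z * Z))%type.
Variable B : option bool -> I -> {set Z}.
Hypothesis twofoldB : forall k, twofold (B k).

Definition tblock (i : index) : {set point} :=
  match i with
  | inl (k, i) => [set (k, t) | t in B k i]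
  | inr (g, (a, b)) => [set (lev0, a); (lev1, b); (lev2, g%:R - a - b)]
  end.

Lemma mem_tblock_level k t k' i :
  ((k, t) \in tblock (inl (k', i))) = (k == k') && (t \in B k' i).
Proof.
apply/imsetP/andP => [[u uB [-> ->]]|[/eqP -> tB]]; first by rewrite eqxx.
by exists t.
Qed.

Lemma mem_tblock_transversal k t g a b :
  ((k, t) \in tblock (inr (g, (a, b)))) =
  (t == if k is Some l then if l then g%:R - a - b else b else a).
Proof. by case: k => [[]|]; rewrite !inE !xpair_eqE /= ?orbF. Qed.

Lemma card_tblock i : #|tblock i| = 3%N.
Proof.
case: i => [[k i]|[g [a b]]].
  by rewrite card_imset; [case: (twofoldB k) | move=> x y []].
by rewrite cards3.
Qed.

(** Points on different levels lie in one transversal triple for each [g], because [g] and two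
    coordinates determine the third; points on one level lie together only in blocks of that
    copy. *)
Lemma tblock_pair (P : {set point}) :
  #|P| = 2%N -> #|[set i | P \subset tblock i]| = 2%N.
Proof.
have pair p q : ([set i | [set p; q] \subset tblock i] =
    [set i | (p \in tblock i) && (q \in tblock i)]).
  by apply/setP=> i; rewrite !inE subUset !sub1set.
(* Two elements are counted by an injective parametrisation by [bool]. *)
have two (h : bool -> index) (X : {set index}) : injective h ->
    (forall i, (i \in X) = (i \in codom h)) -> #|X| = 2%N.
  by move=> ih eX; rewrite (eq_card eX) card_codom // card_bool.
have cross01 s t :
    #|[set i | [set (lev0, s); (lev1, t)] \subset tblock i]| = 2%N.
  rewrite pair; apply: (two (fun g => inr (g, (s, t)))) => [g g' []//|i].
  apply/idP/codomP; rewrite inE.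
    case: i => [[k i]|[g [a b]]].
      by rewrite !mem_tblock_level; case: k => [[]|] /=; rewrite ?andbF.
    rewrite !mem_tblock_transversal => /andP[/eqP -> /eqP ->].
    by exists g.
  by case=> g ->; rewrite !mem_tblock_transversal !eqxx.
have cross02 s t :
    #|[set i | [set (lev0, s); (lev2, t)] \subset tblock i]| = 2%N.
  rewrite pair; apply: (two (fun g => inr (g, (s, g%:R - s - t)))) => [g g' []//|i].
  apply/idP/codomP; rewrite inE.
    case: i => [[k i]|[g [a b]]].
      by rewrite !mem_tblock_level; case: k => [[]|] /=; rewrite ?andbF.
    rewrite !mem_tblock_transversal => /andP[/eqP -> /eqP ->].
    by exists g; congr (inr (_, (_, _))); ring.
  case=> g ->; rewrite !mem_tblock_transversal eqxx /=; apply/eqP; ring.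
have cross12 s t :
    #|[set i | [set (lev1, s); (lev2, t)] \subset tblock i]| = 2%N.
  rewrite pair; apply: (two (fun g => inr (g, (g%:R - s - t, s)))) => [g g' []//|i].
  apply/idP/codomP; rewrite inE.
    case: i => [[k i]|[g [a b]]].
      by rewrite !mem_tblock_level; case: k => [[]|] /=; rewrite ?andbF.
    rewrite !mem_tblock_transversal => /andP[/eqP -> /eqP ->].
    by exists g; congr (inr (_, (_, _))); ring.
  case=> g ->; rewrite !mem_tblock_transversal eqxx /=; apply/eqP; ring.
have same k s t : s != t ->
    #|[set i | [set (k, s); (k, t)] \subset tblock i]| = 2%N.
  move=> st; have [_ c2] := twofoldB k.
  have /c2 <- : #|[set s; t]| = 2%N by rewrite cards2 st.
  have ik : injective (fun i => inl (k, i) : index) by move=> i j [].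
  rewrite pair -(card_imset _ ik).
  apply: eq_card => i; apply/idP/imsetP; rewrite inE.
    case: i => [[k' i]|[g [a b]]].
      rewrite !mem_tblock_level => /andP[/andP[/eqP <- si] /andP[_ ti]].
      by exists i; rewrite // inE subUset !sub1set si ti.
    rewrite !mem_tblock_transversal => /andP[/eqP E /eqP E'].
    by rewrite E E' eqxx in st.
  by case=> j; rewrite inE subUset !sub1set => /andP[sj tj] ->;
     rewrite !mem_tblock_level eqxx sj tj.
move/eqP/cards2P => [[k s] [[k' t] [neq ->]]].
have [kk'|kk'] := eqVneq k k'.
  by move: neq; rewrite -kk' xpair_eqE eqxx /=; apply: same.
by case: k k' kk' {neq} => [[]|] [[]|] // _; rewrite // setUC.
Qed.

Lemma twofold_tblock : twofold tblock.
Proof. by split; [exact: card_tblock | exact: tblock_pair]. Qed.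

(** * The trade inside the tripled system *)

Variables (A b : I) (p : seq I).
Hypotheses (unAbp : uniq [:: A, b & p]) (inAbp : forall i, i \in [:: A, b & p]).
(** Each triple lists first the pivot shared by both ends of the path, then its partner in the block
    of [b], then its partner in that of [last b p]. The pivots are such that two different switched
    triples contain the two end pairs of a copy. *)
Hypothesis BA0 : B lev0 A = [set 1; 2; 0].
Hypothesis BA1 : B lev1 A = [set 2; 0; 1].
Hypothesis BA2 : B lev2 A = [set -1; -2; -3].

(* The cells f(r,j) and g(r,j), with [r] and [j] read modulo [n.+4]. *)
Definition fcell (r j : nat) : index := inr (false, (r%:R, j%:R)).
Definition gcell (r j : nat) : index := inr (true, (r%:R, j%:R)).

Definition switched : seq index :=
  [:: inl (lev0, A); inl (lev1, A); inl (lev2, A);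
      fcell 0 1; fcell 0 2; fcell 1 0; fcell 1 2; fcell 2 0; fcell 2 1].

Definition switched_blocks : seq {set point} :=
  trade_new (lev0, 0) (lev0, 1) (lev0, 2) (lev1, 0) (lev1, 1) (lev1, 2)
    (lev2, -3) (lev2, -2) (lev2, -1).

Definition sblock : index -> {set point} :=
  override tblock switched switched_blocks.

Lemma natr_val (r : nat) : (r%:R : Z) = (r %% n.+4)%N :> nat.
Proof. by rewrite Zp_nat. Qed.

Lemma natr_eq (r s : nat) : (r < n.+4)%N -> (s < n.+4)%N ->
  ((r%:R : Z) == s%:R) = (r == s).
Proof. by move=> rn sn; rewrite -val_eqE /= !natr_val !modn_small. Qed.

Lemma switched_uniq : uniq switched.
Proof. by []. Qed.

(** For distinct [a], [b] among 0, 1, 2 the third point [-a-b] is [-1], [-2] or [-3], which explains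
    the labels on level 2. The order of [switched] is that of [trade_old]. *)
Lemma map_tblock_switched :
  map tblock switched =
  trade_old (lev0, 0) (lev0, 1) (lev0, 2) (lev1, 0) (lev1, 1) (lev1, 2)
    (lev2, -3) (lev2, -2) (lev2, -1).
Proof.
rewrite /trade_old /switched /= BA0 BA1 BA2 !imsetU !imset_set1.
congr [:: _; _; _; _; _; _; _; _; _].
all: try by apply/setP=> t; rewrite !inE; do 3!case: (t == _).
all: congr [set _; _; (_, _)]; ring.
Qed.

Lemma trade_points_uniq :
  uniq [:: (lev0, 0); (lev0, 1); (lev0, 2); (lev1, 0); (lev1, 1); (lev1, 2);
    (lev2, -3); (lev2, -2); (lev2, -1)  : point].
Proof. by rewrite /= !inE !xpair_eqE /= !eqr_opp. Qed.

Lemma twofold_sblock : twofold sblock.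
Proof.
apply: twofold_override switched_uniq _ twofold_tblock _ _ => //.
  exact: trade_new_card trade_points_uniq.
move=> P cP; rewrite -(trade_balance trade_points_uniq cP) -map_tblock_switched.
by rewrite big_map.
Qed.

Notation e := (meet2 sblock).

Lemma e_sym : symmetric e.
Proof. by move=> i j; rewrite /meet2 /= setIC. Qed.

Lemma sblock_free i : i \notin switched -> sblock i = tblock i.
Proof. exact: override_out. Qed.

Lemma gcell_free r j : gcell r j \notin switched.
Proof. by rewrite !inE. Qed.

Lemma copy_free k i : i != A -> inl (k, i) \notin switched.
Proof.
move=> iA; rewrite !inE !orbF; apply/negP.
by do 2?case/orP; move=> /eqP[_ E]; rewrite E eqxx in iA.
Qed.

(** One tuple of equations, so that a single [rewrite] finds the relevant one. *)
Lemma sblock_switched :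
  ((sblock (inl (lev0, A)) = [set (lev0, 1); (lev0, 2); (lev1, 0)]) *
   (sblock (inl (lev1, A)) = [set (lev1, 1); (lev1, 2); (lev2, -3)]) *
   (sblock (inl (lev2, A)) = [set (lev0, 0); (lev2, -2); (lev2, -1)]) *
   (sblock (fcell 0 1) = [set (lev1, 0); (lev1, 2); (lev2, -2)]) *
   (sblock (fcell 0 2) = [set (lev1, 0); (lev1, 1); (lev2, -1)]) *
   (sblock (fcell 1 0) = [set (lev0, 2); (lev2, -3); (lev2, -2)]) *
   (sblock (fcell 1 2) = [set (lev0, 1); (lev2, -3); (lev2, -1)]) *
   (sblock (fcell 2 0) = [set (lev0, 0); (lev0, 2); (lev1, 1)]) *
   (sblock (fcell 2 1) = [set (lev0, 0); (lev0, 1); (lev1, 2)]))%type.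
Proof.
have E j : (j < 9)%N ->
    sblock (nth (fcell 0 0) switched j) = nth set0 switched_blocks j.
  by move=> j9; apply: override_nth; first exact: switched_uniq.
exact: (E 0%N isT, E 1%N isT, E 2%N isT, E 3%N isT, E 4%N isT, E 5%N isT,
        E 6%N isT, E 7%N isT, E 8%N isT).
Qed.

(** * Edges of the switched graph *)

(** The triple of [m] has no point on the third level, so agreeing with the cell on levels [k] and
    [l] gives exactly two common points. [t] is the level-2 coordinate in the form in which the
    switched triples show it. *)
Lemma edge_switch_gcell k l (r j : nat) (t : Z) m : k != l -> t = 1 - r%:R - j%:R ->
  let q k := (k, if k is Some l then if l then t else j%:R else r%:R) : point in
  q k \in sblock m -> q l \in sblock m ->
  (forall h u, h != k -> h != l -> (h, u) \notin sblock m) ->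
  e (gcell r j) m.
Proof.
move=> kl -> q km lm out; have [c3 _] := twofold_sblock.
have [h hk hl] := third_level kl.
have qg h' : q h' \in sblock (gcell r j).
  rewrite sblock_free ?gcell_free // mem_tblock_transversal.
  by case: h' => [[]|].
apply: (@card_setI_pair _ _ _ (q k) (q l) (q h)) => //; last exact: out.
by rewrite xpair_eqE negb_and kl.
Qed.

Local Ltac shared_levels k l t :=
  apply: (@edge_switch_gcell k l _ _ t) => //;
  [ ring
  | by rewrite sblock_switched !inE ?eqxx ?orbT
  | by rewrite sblock_switched !inE ?eqxx ?orbT
  | by case=> [[]|] u // _ _; rewrite sblock_switched !inE !xpair_eqE ].

(** Each of the nine switched triples has two neighbours on the cycle, hence 18 edges: these twelve
    lead to [gcell]s, the other six to the ends of the copies. *)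
Lemma switch_gcell_edges :
  ((e (gcell 2 0) (fcell 0 2)) * (e (gcell 1 1) (fcell 0 2)) *
   (e (gcell 1 2) (fcell 0 1)) * (e (gcell 2 2) (inl (lev1, A))) *
   (e (gcell 2 2) (fcell 1 0)) * (e (gcell 2 1) (fcell 1 0)) *
   (e (gcell 2 1) (fcell 2 0)) * (e (gcell 0 1) (fcell 2 0)) *
   (e (gcell 0 3) (inl (lev2, A))) * (e (gcell 1 3) (fcell 1 2)) *
   (e (gcell 1 0) (inl (lev0, A))) * (e (gcell 0 2) (fcell 2 1)))%type.
Proof.
do !split.
- shared_levels constr:(lev1) constr:(lev2) (-1 : Z).
- shared_levels constr:(lev1) constr:(lev2) (-1 : Z).
- shared_levels constr:(lev1) constr:(lev2) (-2 : Z).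
- shared_levels constr:(lev1) constr:(lev2) (-3 : Z).
- shared_levels constr:(lev0) constr:(lev2) (-3 : Z).
- shared_levels constr:(lev0) constr:(lev2) (-2 : Z).
- shared_levels constr:(lev0) constr:(lev1) (-2 : Z).
- shared_levels constr:(lev0) constr:(lev1) (0 : Z).
- shared_levels constr:(lev0) constr:(lev2) (-2 : Z).
- shared_levels constr:(lev0) constr:(lev2) (-3 : Z).
- shared_levels constr:(lev0) constr:(lev1) (0 : Z).
- shared_levels constr:(lev0) constr:(lev1) (-1 : Z).
Qed.

Lemma edge_copy k i j : i != A -> j != A ->
  e (inl (k, i)) (inl (k, j)) = meet2 (B k) i j.
Proof.
move=> iA jA; rewrite /meet2 /= !sblock_free ?copy_free //= -imsetI ?card_imset //.
  by move=> x y [].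
by move=> x y _ _ [].
Qed.

(** The triple of [m] has a point off level [k], so it shares no third point with a block of the
    copy. *)
Lemma edge_switch_copy k i (s t : Z) m : i != A -> s != t ->
  [set s; t] \subset B k i -> (k, s) \in sblock m -> (k, t) \in sblock m ->
  (exists2 q : point, q \in sblock m & q.1 != k) -> e m (inl (k, i)).
Proof.
rewrite subUset !sub1set => iA st /andP[si ti] sm tm [[h u] qm /= hk].
have [c3 _] := twofold_sblock.
have E := sblock_free (copy_free k iA).
apply: (@card_setI_pair _ _ _ (k, s) (k, t) (h, u)) => //.
- by rewrite xpair_eqE eqxx.
- by rewrite E mem_tblock_level eqxx.
- by rewrite E mem_tblock_level eqxx.
by rewrite E mem_tblock_level (negbTE hk).
Qed.

(** The shared levels are 0 and 1, then 0 and 2, then 1 and 2. In the last two cases the raised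
    index absorbs the 1 in [1 - r - j], so the level-2 point stays. *)
Lemma edge_cell r j :
  fcell r j \notin switched ->
  [/\ e (gcell r j) (fcell r j), e (fcell r j) (gcell r j.+1) &
      e (gcell r.+1 j) (fcell r j)].
Proof.
move=> fr; have [c3 _] := twofold_sblock.
have f01 : (0 : Z) != 1 by [].
split; [|rewrite e_sym|].
- apply: (@card_setI_pair _ _ _ (lev0, r%:R) (lev1, j%:R)
    (lev2, 1 - r%:R - j%:R)) => //;
  rewrite sblock_free ?gcell_free ?mem_tblock_transversal //=.
  by rewrite !(inj_eq (addIr _)).
- apply: (@card_setI_pair _ _ _ (lev0, r%:R) (lev2, - r%:R - j%:R)
    (lev1, j.+1%:R)) => //;
  rewrite sblock_free ?gcell_free ?mem_tblock_transversal //= -?natr1.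
  + by apply/eqP; ring.
  + by apply/eqP; ring.
  by rewrite -subr_eq0 addrAC subrr add0r.
- apply: (@card_setI_pair _ _ _ (lev1, j%:R) (lev2, - r%:R - j%:R)
    (lev0, r.+1%:R)) => //;
  rewrite sblock_free ?gcell_free ?mem_tblock_transversal //= -?natr1.
  + by apply/eqP; ring.
  + by apply/eqP; ring.
  by rewrite -subr_eq0 addrAC subrr add0r.
Qed.

Hypothesis pathB : forall k, path (meet2 (B k)) b p.
Hypotheses (head0 : [set 1; 2] \subset B lev0 b)
           (last0 : [set 1; 0] \subset B lev0 (last b p)).
Hypotheses (head1 : [set 2; 0] \subset B lev1 b)
           (last1 : [set 2; 1] \subset B lev1 (last b p)).
Hypotheses (head2 : [set -1; -2] \subset B lev2 b)
           (last2 : [set -1; -3] \subset B lev2 (last b p)).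

Lemma mem_bp_neqA i : i \in b :: p -> i != A.
Proof. by case/andP: unAbp => + _ ib; apply: contraNneq => <-. Qed.

Local Ltac shared_copy q sub :=
  apply: (edge_switch_copy _ _ sub) => //;
  rewrite ?eqr_opp // ?sblock_switched ?inE ?eqxx ?orbT //;
  by exists q; rewrite // !inE ?eqxx ?orbT.

Lemma switch_copy_edges :
  ((e (inl (lev0, A)) (inl (lev0, b))) *
   (e (fcell 2 1) (inl (lev0, last b p))) *
   (e (fcell 0 1) (inl (lev1, b))) *
   (e (inl (lev1, A)) (inl (lev1, last b p))) *
   (e (inl (lev2, A)) (inl (lev2, b))) *
   (e (fcell 1 2) (inl (lev2, last b p))))%type.
Proof.
have bA : b != A by apply: mem_bp_neqA; rewrite mem_head.
have dA : last b p != A by apply: mem_bp_neqA; rewrite mem_last.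
do !split.
- shared_copy ((lev1, 0) : point) head0.
- shared_copy ((lev1, 2) : point) last0.
- shared_copy ((lev2, -2) : point) head1.
- shared_copy ((lev2, -3) : point) last1.
- shared_copy ((lev0, 0) : point) head2.
- shared_copy ((lev0, 1) : point) last2.
Qed.

(** * The Hamilton cycle *)

(** The list omits the start but includes the end, so walks compose by concatenation and a closed
    walk lists its base point once. *)
Definition walk (x y : index) (s : seq index) := path e x s && (last x s == y).

Lemma walk_cat y x z s t : walk x y s -> walk y z t -> walk x z (s ++ t).
Proof.
rewrite /walk cat_path last_cat => /andP[ps /eqP ->] /andP[pt lt].
by rewrite ps pt.
Qed.

Lemma walk_edge x y z s : e x y -> walk y z s -> walk x z (y :: s).
Proof. by rewrite /walk /= => -> /andP[-> ->]. Qed.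

Lemma walk_nil x : walk x x [::].
Proof. by rewrite /walk /=. Qed.

(** Under this convention the reversed list drops [y] and gains [x], hence [belast]. *)
Lemma walk_rev x y s : walk x y s -> walk y x (rev (belast x s)).
Proof.
case/andP=> ps /eqP <-; rewrite /walk rev_path (eq_path (e' := e)) ?ps //=; last first.
  by move=> i j /=; rewrite e_sym.
by case: s {ps} => //= i s; rewrite rev_cons last_rcons.
Qed.

Definition copy (k : option bool) : seq index := [seq inl (k, i) | i <- b :: p].

Arguments copy : simpl never.

Lemma walk_copy k x : e x (inl (k, b)) -> walk x (inl (k, last b p)) (copy k).
Proof.
move=> exb; apply: walk_edge exb _.
rewrite /walk (last_map (fun i => inl (k, i) : index)) eqxx andbT path_map.
rewrite (@eq_in_path _ [pred i | i != A] _ (meet2 (B k))) //.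
  by move=> i j iA jA; rewrite /relpre /= edge_copy.
by apply/allP=> i /mem_bp_neqA.
Qed.

(** Columns are plain numbers, reduced modulo [n.+4] only inside the cells, so a run may cross the
    seam of the torus. *)
Definition row (r m k : nat) : seq index :=
  flatten [seq [:: fcell r j; gcell r j.+1] | j <- iota m k].

Arguments row : simpl never.

Lemma walk_row x r m k : (0 < k)%N ->
  (forall j, (m <= j < m + k)%N -> fcell r j \notin switched) ->
  e x (fcell r m) -> walk x (gcell r (m + k)) (row r m k).
Proof.
elim: k m x => // k IH m x _ fr exf; rewrite /row /= -/(row r m.+1 k).
have [|_ efg _] := @edge_cell r m; first by rewrite fr // leqnn addnS ltnS leq_addr.
apply: walk_edge exf _; apply: walk_edge efg _.
case: k IH fr => [|k] IH fr; first by rewrite addn1 /row /= walk_nil.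
rewrite -addSnnS; apply: IH => // [j jm|]; first by apply: fr; move: jm; clear; lia.
by have [|-> _ _] := @edge_cell r m.+1; first by apply: fr; clear; lia.
Qed.

Lemma fcell_eq (r j r' j' : nat) :
  (r < n.+4)%N -> (j < n.+4)%N -> (r' < n.+4)%N -> (j' < n.+4)%N ->
  (fcell r j == fcell r' j') = (r == r') && (j == j').
Proof.
move=> rn jn rn' jn'; rewrite -(natr_eq rn rn') -(natr_eq jn jn').
by apply/eqP/andP=> [[-> ->]|[/eqP E /eqP E']]; rewrite ?eqxx // /fcell E E'.
Qed.

Lemma fcell_free (r j : nat) : (r < n.+4)%N -> (j < n.+4)%N ->
  [|| 2 < r, 2 < j | r == j]%N -> fcell r j \notin switched.
Proof.
move=> rn jn h; rewrite /switched !in_cons in_nil !fcell_eq //.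
have neq k : (fcell r j == inl (k, A)) = false by [].
by rewrite !neq; move: h; clear; lia.
Qed.

Lemma natr_congr (j j' : nat) :
  (j = j' %[mod n.+4])%N -> (j%:R : Z) = j'%:R.
Proof. by move=> jj'; apply/val_inj; rewrite /= !natr_val. Qed.

(** Complete rows in descending order from [k + 2] to 3; the shift avoids the rows met by the
    trade. *)
Fixpoint rows (k : nat) : seq index :=
  if k is k'.+1 then row k'.+3 2 n.+4 ++ rows k' else [::].

Arguments rows : simpl never.

Lemma walk_rows k : (k <= n.+1)%N -> walk (gcell k.+3 2) (gcell 3 2) (rows k).
Proof.
elim: k => [|k IH] kn; first exact: walk_nil.
rewrite -[rows k.+1]/(row k.+3 2 n.+4 ++ rows k).
apply: (@walk_cat (gcell k.+3 2)); last exact/IH/ltnW.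
have fr j : fcell k.+3 j \notin switched.
  have -> : fcell k.+3 j = fcell k.+3 (j %% n.+4).
    by rewrite /fcell (@natr_congr (j %% n.+4) j) // modn_mod.
  by apply: fcell_free; rewrite ?ltn_pmod //.
(* A full turn of [n.+4] columns returns to column 2, where the next lower row can be entered. *)
have -> : gcell k.+3 2 = gcell k.+3 (2 + n.+4).
  by rewrite /gcell (@natr_congr (2 + n.+4) 2) // modnDr.
apply: walk_row => //.
by have [_ _ ->] := edge_cell (fr 2%N).
Qed.

(** The closed walk based at [gcell 0 2]: rows [n.+3] down to 3, row 2, copy 1, row 0 backwards,
    copy 2, row 1, copy 0; the explicit lists link these stretches. *)
Definition ham : seq index :=
  rows n.+1 ++ row 2 2 n.+2 ++
  [:: fcell 0 2; gcell 1 1; fcell 1 1; gcell 1 2; fcell 0 1] ++ copy lev1 ++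
  [:: inl (lev1, A); gcell 2 2; fcell 1 0; gcell 2 1; fcell 2 0; gcell 0 1;
      fcell 0 0] ++
  rev (gcell 0 3 :: row 0 3 n.+1) ++ inl (lev2, A) :: copy lev2 ++
  [:: fcell 1 2, gcell 1 3 & row 1 3 n.+1] ++
  inl (lev0, A) :: copy lev0 ++ [:: fcell 2 1; gcell 0 2].

Lemma gcell0n r : gcell r n.+4 = gcell r 0.
Proof. by rewrite /gcell (@natr_congr n.+4 0) // modnn mod0n. Qed.

Lemma walk_ham : walk (gcell 0 2) (gcell 0 2) ham.
Proof.
have fr r j : (r < n.+4)%N -> (j < n.+4)%N -> [|| 2 < r, 2 < j | r == j]%N -> _ :=
  @fcell_free r j.
rewrite /ham; apply: (@walk_cat (gcell 3 2)).
  (* Row 0 is also row [n.+4]: the descent begins by wrapping around the torus. *)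
  have -> : gcell 0 2 = gcell n.+4 2.
    by rewrite /gcell (@natr_congr n.+4 0) // modnn mod0n.
  exact: walk_rows.
apply: (@walk_cat (gcell 2 0)).
  rewrite -gcell0n; apply: (@walk_row _ 2 2 n.+2) => // [j jm|].
    by apply: fr; move: jm; clear; lia.
  by have [_ _ ->] := edge_cell (fr 2%N 2%N isT isT isT).
have [g11 f11 _] := edge_cell (fr 1%N 1%N isT isT isT).
have [g00 f00 _] := edge_cell (fr 0%N 0%N isT isT isT).
apply: (@walk_cat (fcell 0 1)).
  do 5?[apply: walk_edge]; rewrite ?walk_nil ?switch_gcell_edges //.
    by rewrite e_sym switch_gcell_edges.
apply: (@walk_cat (inl (lev1, last b p))).
  by apply: walk_copy; rewrite switch_copy_edges.
apply: (@walk_cat (fcell 0 0)).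
  do 7?[apply: walk_edge]; rewrite ?walk_nil ?switch_gcell_edges //;
  by rewrite e_sym ?switch_gcell_edges ?switch_copy_edges // e_sym.
have row3 r : (r < 3)%N -> walk (gcell r 3) (gcell r 0) (row r 3 n.+1).
  move=> r3; rewrite -gcell0n; apply: (@walk_row _ r 3 n.+1) => // [j jm|].
    by apply: fr; move: r3 jm; clear; lia.
  by have [|-> _ _] := @edge_cell r 3; first by apply: fr; move: r3; clear; lia.
apply: (@walk_cat (gcell 0 3)).
  (* Row 0 is run backwards because [fcell 0 0] leads to its far end [gcell 0 0]. *)
  have /walk_rev w := row3 0%N isT; have /andP[_ /eqP l03] := row3 0%N isT.
  rewrite lastI rev_rcons l03; apply: walk_edge w.
  by rewrite e_sym.
apply: walk_edge; first by rewrite switch_gcell_edges.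
apply: (@walk_cat (inl (lev2, last b p))).
  by apply: walk_copy; rewrite switch_copy_edges.
apply: (@walk_cat (gcell 1 0)).
  apply: walk_edge; first by rewrite e_sym switch_copy_edges.
  apply: walk_edge; first by rewrite e_sym switch_gcell_edges.
  exact: row3.
apply: walk_edge; first by rewrite switch_gcell_edges.
apply: (@walk_cat (inl (lev0, last b p))).
  by apply: walk_copy; rewrite switch_copy_edges.
apply: walk_edge; first by rewrite e_sym switch_copy_edges.
apply: walk_edge; first by rewrite e_sym switch_gcell_edges.
exact: walk_nil.
Qed.

(** * Covering every index exactly once *)

Lemma size_row r m k : size (row r m k) = k.*2.
Proof. by elim: k m => // k IH m; rewrite /row /= -/(row r m.+1 k) IH doubleS. Qed.

Lemma size_rows k : size (rows k) = (k * n.+4.*2)%N.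
Proof.
elim: k => // k IH; rewrite -[rows k.+1]/(row k.+3 2 n.+4 ++ rows k).
by rewrite size_cat size_row IH mulSn.
Qed.

Lemma card_index : #|{: index}| = (3 * (size p).+2 + 2 * (n.+4 * n.+4))%N.
Proof.
have cI : #|I| = (size p).+2.
  rewrite -[RHS]/(size [:: A, b & p]) -(card_uniqP unAbp).
  by apply: eq_card => i; rewrite inAbp.
by rewrite card_sum !card_prod card_option card_bool !card_ord cI.
Qed.

(** This spares a direct proof of uniqueness: a list containing all indices, with as many entries as
    there are indices, has no repetition. *)
Lemma size_ham : size ham = #|{: index}|.
Proof.
have size_cons (i : index) s : size (i :: s) = (size s).+1 by [].
have size_copy k : size (copy k) = (size p).+1 by rewrite size_map.
rewrite card_index /ham.
rewrite !(size_cat, size_rev, size_cons, size_copy, size_row, size_rows).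
by rewrite /=; clear; nia.
Qed.

Lemma mem_row r m k j :
  (m <= j < m + k)%N -> (fcell r j \in row r m k) && (gcell r j.+1 \in row r m k).
Proof.
move=> jm; apply/andP; split; apply/flatten_mapP; exists j;
  by rewrite ?mem_iota // !in_cons eqxx ?orbT.
Qed.

Lemma mem_rows k r : (2 < r < k.+3)%N -> {subset row r 2 n.+4 <= rows k}.
Proof.
elim: k => [|k IH]; first by case: r => [|[|[|]]].
move=> rk i ir; rewrite -[rows k.+1]/(row k.+3 2 n.+4 ++ rows k) mem_cat.
have [E|nE] := eqVneq r k.+3; first by rewrite -E ir.
by rewrite IH ?orbT //; move: rk nE; clear; lia.
Qed.

Lemma mem_ham_cell (r j : nat) : (r < n.+4)%N -> (j < n.+4)%N ->
  (fcell r j \in ham) && (gcell r j \in ham).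
Proof.
move=> rn jn.
have inrows i : i \in rows n.+1 -> i \in ham by apply: mem_catl.
have in2 i : i \in row 2 2 n.+2 -> i \in ham.
  by move=> h; apply: mem_catr; apply: mem_catl.
have in0 i : i \in gcell 0 3 :: row 0 3 n.+1 -> i \in ham.
  by move=> h; do 5!apply: mem_catr; apply: mem_catl; rewrite mem_rev.
have in1 i : i \in gcell 1 3 :: row 1 3 n.+1 -> i \in ham.
  move=> h; do 6!apply: mem_catr; apply: mem_consr; apply: mem_catr; apply: mem_catl.
  exact: mem_consr.
have in5 i : i \in [:: fcell 0 2; gcell 1 1; fcell 1 1; gcell 1 2; fcell 0 1] ->
    i \in ham.
  by move=> h; do 2!apply: mem_catr; apply: mem_catl.
have in7 i : i \in [:: inl (lev1, A); gcell 2 2; fcell 1 0; gcell 2 1;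
    fcell 2 0; gcell 0 1; fcell 0 0] -> i \in ham.
  by move=> h; do 4!apply: mem_catr; apply: mem_catl.
have in12 : fcell 1 2 \in ham.
  do 6!apply: mem_catr; apply: mem_consr; apply: mem_catr; apply: mem_catl.
  exact: mem_head.
have inlast i : i \in [:: fcell 2 1; gcell 0 2] -> i \in ham.
  by move=> h; do 6!apply: mem_catr; apply: mem_consr; do 2!apply: mem_catr;
    apply: mem_consr; apply: mem_catr.
have [f01 f02 f11] : [/\ fcell 0 1 \in ham, fcell 0 2 \in ham & fcell 1 1 \in ham].
  by split; apply: in5; rewrite !in_cons eqxx ?orbT.
have [g11 g12] : gcell 1 1 \in ham /\ gcell 1 2 \in ham.
  by split; apply: in5; rewrite !in_cons eqxx ?orbT.
have [f10 f20 f00] : [/\ fcell 1 0 \in ham, fcell 2 0 \in ham & fcell 0 0 \in ham].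
  by split; apply: in7; rewrite !in_cons eqxx ?orbT.
have [g22 g21 g01] : [/\ gcell 2 2 \in ham, gcell 2 1 \in ham & gcell 0 1 \in ham].
  by split; apply: in7; rewrite !in_cons eqxx ?orbT.
have [f21 g02] : fcell 2 1 \in ham /\ gcell 0 2 \in ham.
  by split; apply: inlast; rewrite !in_cons eqxx ?orbT.
have [g03 g13] : gcell 0 3 \in ham /\ gcell 1 3 \in ham.
  by split; [apply: in0 | apply: in1]; rewrite mem_head.
(* Rows from 3 on are complete; in rows 0, 1, 2 the columns from 3 on lie in partial rows, and the
   corner cells are looked up one by one. *)
have [r3|r3] := leqP 3 r.
  have sub : {subset row r 2 n.+4 <= ham}.
    by move=> i /mem_rows h; apply/inrows/h/andP.
  have f k : (2 <= k < 2 + n.+4)%N -> (fcell r k \in ham) && (gcell r k.+1 \in ham).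
    by move=> /(mem_row r)/andP[/sub -> /sub ->].
  (* The runs start at column 2, so small columns are represented by adding [n.+4]. *)
  have mod2 k : (k%:R : Z) = (k + n.+4)%:R by apply: natr_congr; rewrite modnDr.
  apply/andP; split.
    have [j2|j2] := leqP 2 j.
      by have /andP[] := f j ltac:(move: jn j2; clear; lia).
    rewrite /fcell (mod2 j) -/(fcell _ _).
    by have /andP[] := f (j + n.+4)%N ltac:(move: jn j2; clear; lia).
  case: j jn => [|[|[|j]]] jn.
  - rewrite /gcell (mod2 0%N) -/(gcell _ _).
    by have /andP[] := f n.+3 ltac:(clear; lia).
  - rewrite /gcell (mod2 1%N) -/(gcell _ _).
    by have /andP[] := f n.+4 ltac:(clear; lia).
  - rewrite /gcell (mod2 2%N) -/(gcell _ _).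
    by have /andP[] := f n.+4.+1 ltac:(clear; lia).
  by have /andP[] := f j.+2 ltac:(move: jn; clear; lia).
have fg3 k : (3 <= k < 3 + n.+1)%N ->
    (fcell r k \in ham) && (gcell r k.+1 \in ham).
  move=> kn; case: r r3 {rn} => [|[|[|//]]] _.
  - have /andP[fk gk] := mem_row 0%N kn.
    by apply/andP; split; apply: in0; apply: mem_consr.
  - have /andP[fk gk] := mem_row 1%N kn.
    by apply/andP; split; apply: in1; apply: mem_consr.
  have kn' : (2 <= k < 2 + n.+2)%N by move: kn; clear; lia.
  by have /andP[/in2 -> /in2 ->] := mem_row 2%N kn'.
have gr0 : gcell r 0 \in ham.
  by rewrite -gcell0n; have /andP[] := fg3 n.+3 ltac:(clear; lia).
have [f22 g23] : fcell 2 2 \in ham /\ gcell 2 3 \in ham.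
  by have /andP[/in2 f22 /in2 g23] := @mem_row 2 2 n.+2 2 ltac:(clear; lia).
have [j3|j3] := leqP 3 j.
  have /andP[-> _] := fg3 j ltac:(move: j3 jn; clear; lia).
  case: j j3 jn => [|[|[|[|j]]]] // _ jn.
    by case: r r3 {rn fg3 gr0} => [|[|[|//]]].
  by have /andP[_ ->] := fg3 j.+3 ltac:(move: jn; clear; lia).
case: j j3 {jn} => [|[|[|//]]] _.
all: rewrite ?gr0; case: r r3 {rn fg3 gr0} => [|[|[|//]]] _; rewrite ?andbT //.
all: by apply/andP.
Qed.

Lemma mem_ham i : i \in ham.
Proof.
case: i => [[k i]|[g [x y]]]; last first.
  have /andP[fxy gxy] := mem_ham_cell (ltn_ord x) (ltn_ord y).
  by move: fxy gxy; rewrite /fcell /gcell !natr_Zp; case: g.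
have [->|iA] := eqVneq i A.
  case: k => [[]|].
  - by do 6!apply: mem_catr; apply: mem_head.
  - by do 4!apply: mem_catr; apply: mem_catl; apply: mem_head.
  by do 6!apply: mem_catr; apply: mem_consr; do 2!apply: mem_catr; apply: mem_head.
have : inl (k, i) \in copy k.
  by apply: map_f; have := inAbp i; rewrite in_cons (negbTE iA).
case: k => [[]|] ik.
- by do 6!apply: mem_catr; apply: mem_consr; apply: mem_catl.
- by do 3!apply: mem_catr; apply: mem_catl.
by do 6!apply: mem_catr; apply: mem_consr; do 2!apply: mem_catr;
  apply: mem_consr; apply: mem_catl.
Qed.

Lemma hamiltonian_sblock : hamiltonian e.
Proof.
have sz : (2 < size ham)%N.
  by rewrite size_ham card_index; clear; lia.
(* Moving the last entry, the base point, to the front turns the closed walk into the form expected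
   by [cycle]. *)
have /andP[] := walk_ham; case/lastP: ham sz mem_ham size_ham => // s x sz mem szc pth.
rewrite last_rcons => /eqP xE; exists (x :: s); split=> //.
- by rewrite size_rcons in sz.
- by rewrite /= xE -{2}xE.
- apply: (@leq_size_uniq _ (enum {: index})); first exact: enum_uniq.
    by move=> i _; rewrite -mem_rcons.
  by rewrite -cardE -szc size_rcons.
by move=> i; rewrite -mem_rcons.
Qed.
End Tripling.

Theorem theorem6p2 (v : nat) (hv : 4 <= v) :
  (exists D : tts v, hamiltonian (big2 D)) ->
  exists D : tts (3 * v), hamiltonian (big2 D).
Proof.
case: v hv => [|[|[|[|n]]]] // _ [D hD].
have [A [b [p [un al lab]]]] := hamiltonian_rooted_relabel (card_ord n.+4) hD.
(* The first argument is the pivot: 1, 2 and -1 on levels 0, 1 and 2, as the switched triples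
   require. *)
have [//|B0 [t0 A0 p0 h0 l0]] := lab 1%R 2%R 0%R.
have [//|B1 [t1 A1 p1 h1 l1]] := lab 2%R 0%R 1%R.
have [|B2 [t2 A2 p2 h2 l2]] := lab (-1)%R (-2)%R (-3)%R.
  by rewrite /= !inE !eqr_opp.
pose B k := if k is Some l then if l then B2 else B1 else B0.
have tB k : twofold (B k) by case: k => [[]|].
have pB k : path (meet2 (B k)) b p by case: k => [[]|].
apply: (twofold_hamiltonian _ (@twofold_sblock _ _ B tB A A0 A1 A2)).
  by rewrite card_prod card_option card_bool card_ord.
exact: (@hamiltonian_sblock _ _ B tB A b p un al A0 A1 A2 pB h0 l0 h1 l1 h2 l2).
Qed.
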